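(* Let $K\ge2$. Consider the Search Engine Competition Game with parameter $\beta\in[0,1]$, type distribution $\Gamma$ and selection rule $f$. Suppose that $f$ is non-indifferent and that every correlated equilibrium of the game is deterministic. Then the correlated Price of Anarchy of the game is at most $\frac{2K-1-\beta}{K-\beta}$; that is, every correlated equilibrium $\mathcal C$ satisfies $W(\mathrm{OPT})\le \frac{2K-1-\beta}{K-\beta}\,W(\mathcal C)$.
   Context: Search Engine Competition Game. There are $K$ engines and a set $\Omega$ of $N$ pages. A user type is a pair $(S,t)$ with $S\subseteq\Omega$ and an integer $t\ge 0$. $\Gamma$ is a commonly known distribution over user types, $\gamma(S,t)$ is the probability of $(S,t)$; every page $n\in\Omega$ satisfies $\sum_{S\ni n}\sum_t\gamma(S,t)>0$. A permutation $\sigma$ of the pages places page $\sigma(j)$ in slot $j$; write $\sigma[t]=\{\sigma(j): j\le t\}$. Type $(S,t)$ is satisfied by $\sigma$ iff $\sigma[t]\cap S\neq\emptyset$. A pure strategy of engine $i$ is a probability distribution $\mathcal D_i$ over permutations; its satisfaction probability for type $(S,t)$ is $q_i(S,t,\mathcal D_i)=\Pr_{\sigma\sim\mathcal D_i}[\sigma[t]\cap S\ne\emptyset]$, and $\mathbf q(S,t,\mathbf{\mathcal D})=(q_1,\dots,q_K)$. For a vector, $\mathbf q_{-i}$ denotes $\mathbf q$ without coordinate $i$, and $(y,\mathbf q_{-i})$ is $\mathbf q$ with coordinate $i$ replaced by $y$. A selection rule is a map $f:[0,1]^K\to$ (probability distributions on the $K$ engines), where $f_i(\mathbf q)$ is the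 probability that a user with satisfaction probabilities $\mathbf q$ selects engine $i$; $f_i$ is non-decreasing in $q_i$ and non-increasing in $q_{i'}$ for each $i'\neq i$ (no continuity is assumed). The payoff of engine $i$ in a pure strategy profile $\mathbf{\mathcal D}$ is $$u_i(\mathbf{\mathcal D})=\sum_{S,t}\gamma(S,t)\, f_i(\mathbf q(S,t,\mathbf{\mathcal D}))\,\bigl(\beta+(1-\beta)q_i(S,t,\mathcal D_i)\bigr),$$ and the (searcher) welfare is $W(\mathbf{\mathcal D})=\sum_{S,t}\gamma(S,t)\sum_i f_i(\mathbf q(S,t,\mathbf{\mathcal D}))\,q_i(S,t,\mathcal D_i)$. For randomized (mixed, possibly correlated) profiles, payoff and welfare are the expectations over the realized pure profile. Correlated equilibrium: a finite probability space $(Y,\delta)$, signals $Z_i:Y\to\mathcal Z_i$ ($i=1,\dots,K$), and maps $\mu_i$ from $\mathcal Z_i$ to pure strategies of engine $i$, such that for each $i$ and each map $\mu_i'$ from $\mathcal Z_i$ to pure strategies of $i$, $\mathbb E_\delta[u_i(\mu_1(Z_1),\dots,\mu_i(Z_i),\dots,\mu_K(Z_K))]\ge \mathbb E_\delta[u_i(\mu_1(Z_1),\dots,\mu_i'(Z_i),\dots,\mu_K(Z_K))]$. Two permutations are equivalent (with respect to $\Gamma$) if every type in the support of $\Gamma$ is satisfied by both or by neither. A pure strategy is deterministic if all permutations in its support are equivalent to each other. A correlated equilibrium is deterministic if, for every engine $i$, every pure strategy $\mu_i(Z_i)$ that is played with positive probability is deterministic. Non-indifference: for $\mathbf q\in[0,1]^K$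 let $S(\mathbf q)=\{i:q_i>0\}$. $f$ is non-indifferent if (a) whenever $|S(\mathbf q)|\ge2$ and $q_j<1$ for some $j\in S(\mathbf q)$, there exists $i\in S(\mathbf q)$ with $f_i(\mathbf q)<f_i(1,\mathbf q_{-i})$; and (b) if $q_i=1$ for some $i$, then $f_j(\mathbf q)=0$ for all $j\notin S(\mathbf q)$. $\mathrm{OPT}$ denotes a strategy profile maximizing welfare. The correlated Price of Anarchy is $\sup W(\mathrm{OPT})/W(\mathcal C)$ over all correlated equilibria $\mathcal C$. *)

(* Defs.v *)
From HB Require Import structures.
From mathcomp Require Import all_boot all_order all_algebra all_fingroup.
From mathcomp Require Import all_classical all_reals all_analysis.

Set Implicit Arguments.
Unset Strict Implicit.
Unset Printing Implicit Defensive.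

Import Order.TTheory GRing.Theory Num.Theory.
Import numFieldNormedType.Exports.

Local Open Scope classical_set_scope.
Local Open Scope ring_scope.

Definition is_fdist (R : realType) (T : finType) (p : T -> R) : Prop :=
  (forall x, 0 <= p x) /\ \sum_x p x = 1.

Record fdist (R : realType) (T : finType) := Fdist {
  fdist_fun :> T -> R;
  fdistP : is_fdist fdist_fun }.

(* Patience levels are unbounded, so a type distribution may have infinite
   support. *)
Definition type_distribution (R : realType) (N : nat)
    (gamma : {set 'I_N} -> nat -> R) : Prop :=
  [/\ forall S t, 0 <= gamma S t,
      series (fun t => \sum_(S : {set 'I_N}) gamma S t) @ \oo --> (1 : R) &
      forall n : 'I_N,
        0 < \sum_(S : {set 'I_N} | n \in S) limn (series (gamma S))].

Definition expect_types (R : realType) (N : nat)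
    (gamma : {set 'I_N} -> nat -> R) (g : {set 'I_N} -> nat -> R) : R :=
  \sum_(S : {set 'I_N}) limn (series (fun t => gamma S t * g S t)).

(* Slots are numbered from 0: the first [t] slots are the [j] with [j < t]. *)
Definition top_pages (N : nat) (s : 'S_N) (t : nat) : {set 'I_N} :=
  [set s j | j : 'I_N & (j < t)%N]%SET.

Definition satisfies (N : nat) (s : 'S_N) (S : {set 'I_N}) (t : nat) : bool :=
  (top_pages s t :&: S != finset.set0)%SET.

Definition strategy (R : realType) (N : nat) : Type := fdist R 'S_N.

Definition profile (R : realType) (K N : nat) : Type := 'I_K -> strategy R N.

Definition sat_prob (R : realType) (N : nat) (D : strategy R N)
    (S : {set 'I_N}) (t : nat) : R :=
  \sum_(s : 'S_N | satisfies s S t) D s.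

Definition sat_vector (R : realType) (K N : nat) (D : profile R K N)
    (S : {set 'I_N}) (t : nat) : 'I_K -> R :=
  fun i => sat_prob (D i) S t.

Definition in_cube (R : realType) (K : nat) (q : 'I_K -> R) : Prop :=
  forall i, 0 <= q i <= 1.

(* A selection rule is a function on the cube [0,1]^K; it is represented by a
   function on R^K whose values outside the cube are irrelevant. *)
Definition selection_rule (R : realType) (K : nat)
    (f : ('I_K -> R) -> 'I_K -> R) : Prop :=
  [/\ forall q, in_cube q -> is_fdist (f q),
      forall q i y, in_cube q -> q i <= y <= 1 ->
        f q i <= f [eta q with i |-> y] i &
      forall q i j y, in_cube q -> j != i -> q j <= y <= 1 ->
        f [eta q with j |-> y] i <= f q i].

Definition pos_engines (R : realType) (K : nat) (q : 'I_K -> R) : {set 'I_K} :=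
  [set i | 0 < q i]%SET.

Definition non_indifferent (R : realType) (K : nat)
    (f : ('I_K -> R) -> 'I_K -> R) : Prop :=
  (forall q, in_cube q -> (2 <= #|pos_engines q|)%N ->
     (exists2 j, j \in pos_engines q & q j < 1) ->
     exists2 i, i \in pos_engines q & f q i < f [eta q with i |-> 1] i) /\
  (forall q, in_cube q -> (exists i, q i = 1) ->
     forall j, j \notin pos_engines q -> f q j = 0).

Definition payoff (R : realType) (K N : nat) (beta : R)
    (gamma : {set 'I_N} -> nat -> R) (f : ('I_K -> R) -> 'I_K -> R)
    (i : 'I_K) (D : profile R K N) : R :=
  expect_types gamma (fun S t =>
    f (sat_vector D S t) i * (beta + (1 - beta) * sat_prob (D i) S t)).

Definition welfare (R : realType) (K N : nat)
    (gamma : {set 'I_N} -> nat -> R) (f : ('I_K -> R) -> 'I_K -> R)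
    (D : profile R K N) : R :=
  expect_types gamma (fun S t =>
    \sum_i f (sat_vector D S t) i * sat_prob (D i) S t).

(* The welfare of an optimal profile, as the supremum of a nonempty set of reals
   bounded by 1; randomizing over profiles cannot exceed it. *)
Definition opt_welfare (R : realType) (K N : nat)
    (gamma : {set 'I_N} -> nat -> R) (f : ('I_K -> R) -> 'I_K -> R) : R :=
  sup [set welfare gamma f D | D in [set: profile R K N]].

Record correlated_profile (R : realType) (K N : nat) := CorrelatedProfile {
  cp_space : finType;
  cp_prob : fdist R cp_space;
  cp_signal : 'I_K -> Type;
  cp_observe : forall i, cp_space -> cp_signal i;
  cp_play : forall i, cp_signal i -> strategy R N }.

Arguments cp_play {R K N} c {i} _.
Arguments cp_observe {R K N} c i _.

Definition realized (R : realType) (K N : nat) (C : correlated_profile R K N)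
    (y : cp_space C) : profile R K N :=
  fun i => cp_play C (cp_observe C i y).

Definition expected (R : realType) (K N : nat) (C : correlated_profile R K N)
    (u : cp_space C -> R) : R :=
  \sum_(y : cp_space C) cp_prob C y * u y.

Arguments expected {R K N} C u.

Definition correlated_welfare (R : realType) (K N : nat)
    (gamma : {set 'I_N} -> nat -> R) (f : ('I_K -> R) -> 'I_K -> R)
    (C : correlated_profile R K N) : R :=
  expected C (fun y => welfare gamma f (realized y)).

Definition correlated_equilibrium (R : realType) (K N : nat) (beta : R)
    (gamma : {set 'I_N} -> nat -> R) (f : ('I_K -> R) -> 'I_K -> R)
    (C : correlated_profile R K N) : Prop :=
  forall (i : 'I_K) (mu' : cp_signal C i -> strategy R N),
    expected C (fun y => payoff beta gamma f i
      [eta realized y with i |-> mu' (cp_observe C i y)])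
    <= expected C (fun y => payoff beta gamma f i (realized y)).

Definition equivalent_perms (R : realType) (N : nat)
    (gamma : {set 'I_N} -> nat -> R) (s s' : 'S_N) : Prop :=
  forall S t, 0 < gamma S t -> satisfies s S t = satisfies s' S t.

Definition deterministic_strategy (R : realType) (N : nat)
    (gamma : {set 'I_N} -> nat -> R) (D : strategy R N) : Prop :=
  forall s s', 0 < D s -> 0 < D s' -> equivalent_perms gamma s s'.

Definition deterministic_profile (R : realType) (K N : nat)
    (gamma : {set 'I_N} -> nat -> R) (C : correlated_profile R K N) : Prop :=
  forall (i : 'I_K) (y : cp_space C),
    0 < cp_prob C y -> deterministic_strategy gamma (realized y i).

(* Main.v *)
(* In a deterministic profile every user type is either satisfied or missed by each
   engine, so non-indifference makes the welfare the mass of the covered types and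
   the total payoff at a type equal to 1 if it is covered and to beta otherwise.
   Fix permutations s_1, ..., s_K and let every engine i deviate to every s_j.  If
   s_j satisfies a type, then over i these deviations earn K there when the type is
   uncovered in equilibrium, and at least 1 otherwise, because by monotonicity
   raising q_i to 1 does not lower f_i and the f_i sum to 1.  Summing the K^2
   equilibrium inequalities gives
     (K - beta) cov(s) <= (2K - 1 - beta) W(C),
   and the welfare of any profile is at most an average of such coverages. *)
Require Import Defs.
From HB Require Import structures.
From mathcomp Require Import all_boot all_order all_algebra all_fingroup.
From mathcomp Require Import all_classical all_reals all_analysis.
From mathcomp Require Import ring lra.
Set Implicit Arguments.
Unset Strict Implicit.
Unset Printing Implicit Defensive.

Import Order.TTheory GRing.Theory Num.Theory.
Import numFieldNormedType.Exports.
Local Open Scope ring_scope.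

(** * Expectation over user types: convergence, linearity, monotonicity *)

Definition bounded_on_types (R : realType) (N : nat)
    (g : {set 'I_N} -> nat -> R) : Prop :=
  exists M, forall S t, `|g S t| <= M.

Section TypeExpectation.

Context {R : realType} {N : nat} {gamma : {set 'I_N} -> nat -> R}.
Hypothesis hgamma : type_distribution gamma.
Implicit Types g h : {set 'I_N} -> nat -> R.

Lemma bounded_on_typesD g h :
  bounded_on_types g -> bounded_on_types h ->
  bounded_on_types (fun S t => g S t + h S t).
Proof.
move=> [M hM] [M' hM']; exists (M + M') => S t.
exact: le_trans (ler_normD _ _) (lerD (hM S t) (hM' S t)).
Qed.

Lemma bounded_on_typesZ (a : R) g :
  bounded_on_types g -> bounded_on_types (fun S t => a * g S t).
Proof.
move=> [M hM]; exists (`|a| * M) => S t.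
by rewrite normrM ler_wpM2l.
Qed.

Lemma bounded_on_types_sum (I : finType) (g : I -> {set 'I_N} -> nat -> R) :
  (forall x, bounded_on_types (g x)) ->
  bounded_on_types (fun S t => \sum_x g x S t).
Proof.
move=> /choice[M hM]; exists (\sum_x M x) => S t.
apply: le_trans (ler_norm_sum _ _ _) _.
by apply: ler_sum => x _; exact: hM.
Qed.

(** Comparison with the total mass over all page sets, whose series converges by hypothesis. *)
Lemma is_cvg_types S : cvgn (series (gamma S)).
Proof.
case: hgamma => gamma_ge0 gamma_cvg _.
apply: (series_le_cvg (v_ := fun t => \sum_(S' : {set 'I_N}) gamma S' t)).
- exact: gamma_ge0.
- by move=> t; apply: sumr_ge0.
- by move=> t; rewrite (bigD1 S)//= lerDl; apply: sumr_ge0.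
- exact: cvgP gamma_cvg.
Qed.

(** Absolute convergence, by comparison with [M *: gamma S]. Since [limn] has only a default value
    on divergent series, boundedness is carried through all the rules below. *)
Lemma is_cvg_expect_types {g} S : bounded_on_types g ->
  cvgn (series (fun t => gamma S t * g S t)).
Proof.
case: (hgamma) => gamma_ge0 _ _ [M hM].
apply: normed_cvg.
apply: (series_le_cvg (v_ := M *: gamma S)).
- by move=> t; exact: normr_ge0.
- move=> t; apply: mulr_ge0 => //.
  exact: le_trans (normr_ge0 _) (hM S t).
- by move=> t /=; rewrite normrM ger0_norm// mulrC ler_wpM2r.
- by apply: is_cvg_seriesZ; exact: is_cvg_types.
Qed.

Lemma expect_typesD g h : bounded_on_types g -> bounded_on_types h ->
  expect_types gamma (fun S t => g S t + h S t) =
  expect_types gamma g + expect_types gamma h.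
Proof.
move=> bg bh; rewrite /expect_types -big_split/=; apply: eq_bigr => S _.
rewrite -lim_seriesD; try exact: is_cvg_expect_types.
by congr (limn (series _)); apply/funext => t; rewrite /= mulrDr.
Qed.

Lemma expect_typesZ (a : R) g : bounded_on_types g ->
  expect_types gamma (fun S t => a * g S t) = a * expect_types gamma g.
Proof.
move=> bg; rewrite /expect_types big_distrr/=; apply: eq_bigr => S _.
rewrite -[RHS]lim_seriesZ; last exact: is_cvg_expect_types.
by congr (limn (series _)); apply/funext => t; rewrite /= mulrCA.
Qed.

Lemma expect_types_sum (I : finType) (g : I -> {set 'I_N} -> nat -> R) :
  (forall x, bounded_on_types (g x)) ->
  expect_types gamma (fun S t => \sum_x g x S t) =
  \sum_x expect_types gamma (g x).
Proof.
move=> bg; rewrite /expect_types exchange_big/=; apply: eq_bigr => S _.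
transitivity (limn (\sum_x series (fun t => gamma S t * g x S t))).
  congr (limn _); apply/funext => n; rewrite fct_sumE /series/= exchange_big/=.
  by apply: eq_bigr => t _; rewrite mulr_sumr.
apply/cvg_lim => //; rewrite fct_sumE; apply: cvg_big => [|x _].
  exact: add_continuous.
exact: is_cvg_expect_types S (bg x).
Qed.

(** Types of probability 0 contribute 0 to both sides. Comparing on the support only matters later,
    because determinism says nothing about other types. *)
Lemma le_expect_types g h : bounded_on_types g -> bounded_on_types h ->
  (forall S t, 0 < gamma S t -> g S t <= h S t) ->
  expect_types gamma g <= expect_types gamma h.
Proof.
move=> bg bh gh; case: (hgamma) => gamma_ge0 _ _.
apply: ler_sum => S _; apply: lim_series_le; try exact: is_cvg_expect_types.
move=> t; have := gamma_ge0 S t; rewrite le_eqVlt => /predU1P[<-|gt0].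
  by rewrite !mul0r.
by rewrite ler_pM2l// gh.
Qed.

End TypeExpectation.

(** * Satisfaction probabilities of strategies *)

Section Strategies.

Context {R : realType} {K N : nat}.

Lemma sat_prob_ge0 (D : strategy R N) S t : 0 <= sat_prob D S t.
Proof. by have [D_ge0 _] := fdistP D; apply: sumr_ge0. Qed.

Lemma sat_prob_le1 (D : strategy R N) S t : sat_prob D S t <= 1.
Proof.
have [D_ge0 <-] := fdistP D.
rewrite /sat_prob [leRHS](bigID (fun s => satisfies s S t))/= lerDl.
exact: sumr_ge0.
Qed.

Lemma sat_vector_in_cube (D : profile R K N) S t : in_cube (sat_vector D S t).
Proof. by move=> i; rewrite sat_prob_ge0 sat_prob_le1. Qed.

Lemma dirac_is_fdist (s : 'S_N) : is_fdist (fun x => (x == s)%:R : R).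
Proof.
split=> [x|]; first exact: ler0n.
rewrite (bigD1 s)//= eqxx big1 ?addr0// => x /negbTE ->//.
Qed.

Definition dirac_strategy (s : 'S_N) : strategy R N := Fdist (dirac_is_fdist s).

Lemma sat_prob_dirac (s : 'S_N) S t :
  sat_prob (dirac_strategy s) S t = (satisfies s S t)%:R.
Proof.
rewrite /sat_prob big_mkcond (bigD1 s)//= eqxx big1.
  by rewrite addr0; case: ifP.
by move=> x /negbTE xs; case: ifP => // _; rewrite xs.
Qed.

(** All permutations in the support agree on the type with one fixed [s] of positive mass, so the
    sum is the whole mass or nothing. *)
Lemma deterministic_sat_prob (gamma : {set 'I_N} -> nat -> R)
    (D : strategy R N) S t :
  deterministic_strategy gamma D -> 0 < gamma S t ->
  exists b : bool, sat_prob D S t = b%:R.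
Proof.
move=> detD gt0; have [D_ge0 D1] := fdistP D.
have [s Ds] : exists s, 0 < D s.
  apply/existsP/contraT => /existsPn D_le0.
  have /eqP := D1; rewrite big1 ?(eq_sym 0) ?oner_eq0// => s _.
  by apply/eqP; rewrite eq_le D_ge0 leNgt D_le0.
exists (satisfies s S t); rewrite /sat_prob big_mkcond/=.
transitivity (\sum_x D x * (satisfies s S t)%:R); last first.
  by rewrite -mulr_suml D1 mul1r.
apply: eq_bigr => x _.
have := D_ge0 x; rewrite le_eqVlt => /predU1P[<-|Dx].
  by rewrite mul0r if_same.
rewrite -(detD _ _ Dx Ds S t gt0); case: ifP => _; by rewrite ?mulr1 ?mulr0.
Qed.

Lemma sat_vector_deviation (D : profile R K N) i (E : strategy R N) S t :
  sat_vector [eta D with i |-> E] S t =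
  [eta sat_vector D S t with i |-> sat_prob E S t].
Proof. by apply/funext => j; rewrite /sat_vector/=; case: ifP. Qed.

End Strategies.

(** * The smoothness inequality at one user type *)

Section SelectionRule.

Context {R : realType} {K : nat} {f : ('I_K -> R) -> 'I_K -> R}.
Hypothesis hf : selection_rule f.
Implicit Types q : 'I_K -> R.

Lemma selection_ge0 q i : in_cube q -> 0 <= f q i.
Proof. by case: hf => hfd _ _ /hfd[+ _]. Qed.

Lemma selection_sum q : in_cube q -> \sum_i f q i = 1.
Proof. by case: hf => hfd _ _ /hfd[]. Qed.

Lemma selection_le1 q i : in_cube q -> f q i <= 1.
Proof.
move=> hq; rewrite -(selection_sum hq) (bigD1 i)//= lerDl.
by apply: sumr_ge0 => j _; exact: selection_ge0.
Qed.

Lemma in_cube_update q i (y : R) : in_cube q -> 0 <= y <= 1 ->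
  in_cube [eta q with i |-> y].
Proof. by move=> hq hy j /=; case: ifP. Qed.

Hypothesis hni : non_indifferent f.
Hypothesis hK : (2 <= K)%N.
Variable beta : R.
Hypothesis hbeta : 0 <= beta <= 1.

(* At a single user type, [b i] says whether engine [i] satisfies it in the
   equilibrium and [c j] whether the [j]-th benchmark permutation does; the
   double sum lets every engine deviate to every benchmark permutation. *)
Lemma local_smoothness (b c : 'I_K -> bool) q :
  q = (fun i => (b i)%:R) ->
  (K%:R - beta) * ([exists j, c j])%:R
    + K%:R * (\sum_i f q i * (beta + (1 - beta) * q i))
  <= \sum_i \sum_j f [eta q with i |-> (c j)%:R] i
       * (beta + (1 - beta) * (c j)%:R)
    + (2 * K%:R - 1 - beta) * \sum_i f q i * q i.
Proof.
move=> qb; have [_ nib] := hni; have qE i : q i = (b i)%:R by rewrite qb.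
have /andP[beta0 beta1] := hbeta.
have hq : in_cube q by move=> i; rewrite qE ler0n lern1 leq_b1.
have hc (x : bool) : 0 <= (x%:R : R) <= 1 by rewrite ler0n lern1 leq_b1.
have K_ge2 : 2 <= K%:R :> R by rewrite ler_nat.
have [bT|/existsPn b0] := boolP [exists i, b i].
(* Covered type: part (b) of non-indifference gives selection probability 0 to each engine that
   misses it. *)
- have fq i : f q i * q i = f q i.
    rewrite qE; case: (boolP (b i)) => bi; first by rewrite mulr1.
    rewrite mulr0; apply/esym/nib => //.
      by have /existsP[k bk] := bT; exists k; rewrite qE bk.
    by rewrite inE qE (negbTE bi) ltxx.
  have -> : \sum_i f q i * (beta + (1 - beta) * q i) = 1.
    rewrite -[RHS](selection_sum hq); apply: eq_bigr => i _.
    by rewrite mulrDr [X in _ + X]mulrCA fq; ring.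
  have -> : \sum_i f q i * q i = 1.
    by under eq_bigr do rewrite fq; exact: selection_sum.
  rewrite exchange_big/=.
  have dev_ge (j : 'I_K) : (c j)%:R <=
      \sum_i f [eta q with i |-> (c j)%:R] i * (beta + (1 - beta) * (c j)%:R).
    have [cj|cj] := boolP (c j).
      rewrite -[leLHS](selection_sum hq); apply: ler_sum => i _.
      rewrite mulr1 subrKC mulr1; case: hf => _ mono _.
      by apply: mono => //; rewrite lexx andbT; case/andP: (hq i).
    apply: sumr_ge0 => i _; rewrite mulr0 addr0 mulr_ge0//.
    by apply: selection_ge0; apply: in_cube_update; rewrite // lexx ler01.
  have /le_trans dev : ([exists j, c j])%:R <= \sum_j (c j)%:R :> R.
    case: existsP => [[j cj]|_]; last by apply: sumr_ge0 => j _; rewrite ler0n.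
    by rewrite (bigD1 j)//= cj lerDl sumr_ge0// => l _; rewrite ler0n.
  have := dev _ (ler_sum _ (fun j _ => dev_ge j)).
  (* This product is exactly the slack left after bounding the deviation payoffs by
     [[exists j, c j]]. *)
  have : 0 <= (K%:R - 1 - beta) * (1 - [exists j, c j]%:R) :> R.
    by apply: mulr_ge0; [lra|case/andP: (hc [exists j, c j]) => _; lra].
  move: (\sum_j _) => d; lra.
- have q0 i : q i = 0 by rewrite qE (negbTE (b0 i)).
  (* Uncovered type: if [c j] holds, the deviator alone satisfies the type and part (b) makes every
     user select it; otherwise the deviation leaves [q] unchanged. *)
  have dev (j i : 'I_K) :
      f [eta q with i |-> (c j)%:R] i * (beta + (1 - beta) * (c j)%:R) =
      beta * f q i + (c j)%:R * (1 - beta * f q i).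
    case: (c j).
      have hq1 : in_cube [eta q with i |-> 1].
        by apply: in_cube_update; rewrite // ler01 lexx.
      have -> : f [eta q with i |-> 1] i = 1.
        rewrite -[RHS](selection_sum hq1) (bigD1 i)//= big1 ?addr0// => l li.
        apply: nib => //; first by exists i; rewrite /= eqxx.
        by rewrite inE /= (negbTE li) q0 ltxx.
      by rewrite mulr1n; ring.
    have -> : [eta q with i |-> 0] = q :> ('I_K -> R) by apply/funext => l /=; rewrite q0 if_same.
    by rewrite mulr0n; ring.
  (* Each benchmark contributes [beta] summed over the engines, plus [K - beta] more if it satisfies
     the type. *)
  have -> : \sum_i \sum_j f [eta q with i |-> (c j)%:R] i
        * (beta + (1 - beta) * (c j)%:R) =
      K%:R * beta + (\sum_j (c j)%:R) * (K%:R - beta).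
    rewrite exchange_big/= mulr_suml mulr_natl -[X in beta *+ X]card_ord.
    rewrite -sumr_const -big_split/=; apply: eq_bigr => j _.
    under eq_bigr do rewrite dev.
    rewrite big_split/= -!mulr_sumr sumrB -mulr_sumr (selection_sum hq) mulr1.
    by rewrite sumr_const card_ord.
  have -> : \sum_i f q i * (beta + (1 - beta) * q i) = beta.
    under eq_bigr do rewrite q0 mulr0 addr0.
    by rewrite -mulr_suml (selection_sum hq) mul1r.
  rewrite [X in _ <= _ + _ * X]big1 ?mulr0 ?addr0; last first.
    by move=> i _; rewrite q0 mulr0.
  rewrite addrC lerD2l mulrC; apply: ler_wpM2r; first by lra.
  case: existsP => [[j cj]|_]; last by apply: sumr_ge0 => j _; rewrite ler0n.
  by rewrite (bigD1 j)//= cj lerDl sumr_ge0// => l _; rewrite ler0n.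
Qed.

End SelectionRule.

(** * Coverage bounds and smoothness for whole profiles *)

Section Game.

Context {R : realType} {K N : nat} {gamma : {set 'I_N} -> nat -> R}.
Context {f : ('I_K -> R) -> 'I_K -> R} {beta : R}.
Hypotheses (hgamma : type_distribution gamma) (hf : selection_rule f).
Hypothesis hbeta : 0 <= beta <= 1.
Implicit Types (D : profile R K N) (sigma : 'I_K -> 'S_N).

Lemma itv01_bounded (g : {set 'I_N} -> nat -> R) :
  (forall S t, 0 <= g S t <= 1) -> bounded_on_types g.
Proof.
by move=> g01; exists 1 => S t; case/andP: (g01 S t) => ? ?; rewrite ger0_norm.
Qed.

Lemma payoff_bounded D i :
  bounded_on_types (fun S t =>
    f (sat_vector D S t) i * (beta + (1 - beta) * sat_prob (D i) S t)).
Proof.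
apply: itv01_bounded => S t.
have hq := sat_vector_in_cube D S t; have /andP[beta0 beta1] := hbeta.
have := sat_prob_ge0 (D i) S t; have := sat_prob_le1 (D i) S t.
move: (sat_prob _ _ _) => p p1 p0.
have := selection_ge0 hf i hq; have := selection_le1 hf i hq.
move: (f _ _) => x x1 x0.
have y0 : 0 <= beta + (1 - beta) * p by rewrite addr_ge0// mulr_ge0// subr_ge0.
have y1 : beta + (1 - beta) * p <= 1 by nra.
by rewrite mulr_ge0//= mulr_ile1.
Qed.

Lemma welfare_bounded D :
  bounded_on_types (fun S t => \sum_i f (sat_vector D S t) i * sat_prob (D i) S t).
Proof.
apply: bounded_on_types_sum => i; apply: itv01_bounded => S t.
have hq := sat_vector_in_cube D S t.
rewrite mulr_ge0 ?sat_prob_ge0 ?selection_ge0//=.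
by rewrite mulr_ile1 ?sat_prob_ge0 ?sat_prob_le1 ?selection_ge0 ?selection_le1.
Qed.

Definition covered sigma (S : {set 'I_N}) (t : nat) : R :=
  [exists j, satisfies (sigma j) S t]%:R.

Lemma covered_bounded sigma : bounded_on_types (covered sigma).
Proof. by apply: itv01_bounded => S t; rewrite /covered ler0n lern1 leq_b1. Qed.

(* Drawing one permutation per engine independently from [D] turns the fractional
   satisfaction probabilities into coverage by tuples of permutations. *)
Lemma welfare_le_mean_coverage D :
  welfare gamma f D <= \sum_(sigma : {ffun 'I_K -> 'S_N})
    (\prod_i D i (sigma i)) * expect_types gamma (covered sigma).
Proof.
have bcov (sigma : {ffun 'I_K -> 'S_N}) : bounded_on_types (fun S t =>
    (\prod_i D i (sigma i)) * covered sigma S t).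
  exact/bounded_on_typesZ/covered_bounded.
under eq_bigr do rewrite -(expect_typesZ hgamma _ (covered_bounded _)).
rewrite -(expect_types_sum hgamma bcov).
apply: (le_expect_types hgamma); first exact: welfare_bounded.
  exact: bounded_on_types_sum.
move=> S t _; set m := (leRHS).
have hq := sat_vector_in_cube D S t.
(* Writing 1 as the sum of the [f_k] reduces the claim to each engine's satisfaction probability
   being at most [m]. *)
rewrite -[m]mul1r -(selection_sum hf hq) mulr_suml.
apply: ler_sum => k _; apply: ler_wpM2l; first exact: selection_ge0.
(* The factors with [i != k] are total masses 1; in this product form distributivity expands engine
   [k]'s probability over all tuples. *)
apply: (@le_trans _ _ (\prod_i \sum_(s : 'S_N)
    (D i s * (if i == k then (satisfies s S t)%:R else 1)))).
  rewrite (bigD1 k)//= [X in _ * X]big1 ?mulr1; last first.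
    move=> i /negbTE ik; under eq_bigr do rewrite ik mulr1.
    by have [] := fdistP (D i).
  rewrite /sat_prob big_mkcond/=; apply: ler_sum => s _.
  by rewrite eqxx; case: ifP; rewrite ?mulr1 ?mulr0.
rewrite bigA_distr_bigA/=; apply: ler_sum => sigma _.
rewrite big_split/=; apply: ler_wpM2l.
  by apply: prodr_ge0 => i _; have [] := fdistP (D i).
rewrite (bigD1 k)//= eqxx big1 ?mulr1; last by move=> i /negbTE ->.
rewrite /covered ler_nat; case: (boolP (satisfies _ _ _)) => // sat.
by rewrite lt0b; apply/existsP; exists k.
Qed.

(** The product weights sum to 1, so the mean coverage is at most any common bound: fixed tuples of
    permutations suffice as benchmarks. *)
Lemma welfare_le_coverage D (m : R) :
  (forall sigma, expect_types gamma (covered sigma) <= m) ->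
  welfare gamma f D <= m.
Proof.
move=> cov_le; apply: le_trans (welfare_le_mean_coverage D) _.
have prod1 : \sum_(sigma : {ffun 'I_K -> 'S_N}) \prod_i D i (sigma i) = 1.
  rewrite -(bigA_distr_bigA (fun i s => D i s)) big1// => i _.
  by have [] := fdistP (D i).
rewrite -[m]mul1r -[X in _ <= X * _]prod1 mulr_suml; apply: ler_sum => sigma _.
apply: ler_wpM2l => //.
by apply: prodr_ge0 => i _; have [] := fdistP (D i).
Qed.

Hypotheses (hK : (2 <= K)%N) (hni : non_indifferent f).

(** The expectation over types of [local_smoothness], applicable because determinism makes the
    satisfaction vector Boolean on the support. *)
Lemma deterministic_smoothness D sigma :
  (forall i, deterministic_strategy gamma (D i)) ->
  (K%:R - beta) * expect_types gamma (covered sigma)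
    + K%:R * (\sum_i payoff beta gamma f i D)
  <= \sum_i \sum_j payoff beta gamma f i
       [eta D with i |-> dirac_strategy (sigma j)]
    + (2 * K%:R - 1 - beta) * welfare gamma f D.
Proof.
move=> detD.
have bdev i j := payoff_bounded [eta D with i |-> dirac_strategy (sigma j)] i.
have bpay i := payoff_bounded D i.
have bcov := covered_bounded sigma; have bwel := welfare_bounded D.
rewrite /payoff /welfare.
rewrite -(expect_types_sum hgamma bpay).
under eq_bigr do rewrite -(expect_types_sum hgamma (bdev _)).
have bdevs i := bounded_on_types_sum (bdev i).
have bpays := bounded_on_types_sum bpay.
rewrite -(expect_types_sum hgamma bdevs).
have bdevss := bounded_on_types_sum bdevs.
rewrite -!(expect_typesZ hgamma)//.
rewrite -!(expect_typesD hgamma); do ?exact: bounded_on_typesZ; last exact: bdevss.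
apply: (le_expect_types hgamma).
- by apply: bounded_on_typesD; exact: bounded_on_typesZ.
- by apply: bounded_on_typesD; [exact: bdevss|exact: bounded_on_typesZ].
move=> S t gt0.
have /choice[b bE] i := deterministic_sat_prob (detD i) gt0.
have qb : sat_vector D S t = fun i => (b i)%:R by apply/funext.
have := local_smoothness hf hni hK hbeta (fun j => satisfies (sigma j) S t) qb.
congr (_ <= _ + _); apply: eq_bigr => i _; apply: eq_bigr => j _.
by rewrite sat_vector_deviation /= eqxx sat_prob_dirac.
Qed.

End Game.

(** * Averaging over the correlated equilibrium *)

Theorem theorem3p2 (R : realType) (K N : nat) (beta : R)
    (gamma : {set 'I_N} -> nat -> R) (f : ('I_K -> R) -> 'I_K -> R)
    (hK : (2 <= K)%N) (hbeta : 0 <= beta <= 1)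
    (hgamma : type_distribution gamma) (hf : selection_rule f)
    (hni : non_indifferent f)
    (hdet : forall C : correlated_profile R K N,
       correlated_equilibrium beta gamma f C -> deterministic_profile gamma C) :
  forall C : correlated_profile R K N,
    correlated_equilibrium beta gamma f C ->
    opt_welfare gamma f
    <= (2 * K%:R - 1 - beta) / (K%:R - beta) * correlated_welfare gamma f C.
Proof.
move=> C eqC.
have K_ge2 : 2 <= K%:R :> R by rewrite ler_nat.
have /andP[beta0 beta1] := hbeta.
have Kb_gt0 : 0 < K%:R - beta by lra.
apply: ge_sup.
  exists (welfare gamma f (fun=> dirac_strategy 1%g)).
  by exists (fun=> dirac_strategy 1%g).
move=> _ [D _ <-]; apply: welfare_le_coverage => // sigma.
rewrite mulrAC ler_pdivlMr// mulrC.
have [prob_ge0 prob1] := fdistP (cp_prob C).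
have smooth : expected C (fun y =>
      (K%:R - beta) * expect_types gamma (covered sigma)
      + K%:R * (\sum_i payoff beta gamma f i (realized y)))
    <= expected C (fun y =>
      \sum_i \sum_j payoff beta gamma f i
        [eta realized y with i |-> dirac_strategy (sigma j)]
      + (2 * K%:R - 1 - beta) * welfare gamma f (realized y)).
  apply: ler_sum => y _.
  (* Determinism is known only at states of positive probability; the others have weight 0. *)
  have := prob_ge0 y; rewrite le_eqVlt => /predU1P[<-|y_gt0].
    by rewrite !mul0r.
  rewrite ler_pM2l//; apply: deterministic_smoothness => // i.
  exact: hdet eqC _ _ y_gt0.
have expectedD u v : expected C (fun y => u y + v y) = expected C u + expected C v.
  by rewrite /expected -big_split/=; apply: eq_bigr => y _; rewrite mulrDr.
have expectedZ a u : expected C (fun y => a * u y) = a * expected C u.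
  by rewrite /expected mulr_sumr; apply: eq_bigr => y _; rewrite mulrCA.
have expected_sum (u : 'I_K -> cp_space C -> R) :
    expected C (fun y => \sum_i u i y) = \sum_i expected C (u i).
  rewrite /expected exchange_big/=.
  by apply: eq_bigr => y _; rewrite mulr_sumr.
have dev : expected C (fun y => \sum_i \sum_j payoff beta gamma f i
        [eta realized y with i |-> dirac_strategy (sigma j)])
    <= K%:R * expected C (fun y => \sum_i payoff beta gamma f i (realized y)).
  rewrite !expected_sum mulr_sumr; apply: ler_sum => i _.
  rewrite expected_sum mulr_natl -[X in _ *+ X]card_ord -sumr_const.
  apply: ler_sum => j _.
  (* The deviation ignores the signal and always plays [sigma j]. *)
  exact: (eqC i (fun=> dirac_strategy (sigma j))).
move: smooth; rewrite !expectedD !expectedZ /correlated_welfare.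
rewrite {1}/expected -mulr_suml prob1 mul1r => smooth.
(* By [dev], the deviation payoffs are at most [K] times the total equilibrium payoff, which cancels
   against the same term on the left of [smooth]. *)
by rewrite -(lerD2r (K%:R * expected C (fun y =>
  \sum_i payoff beta gamma f i (realized y)))) (le_trans smooth)// addrC lerD2l.
Qed.
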